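(* Let $\mathcal{X}=\bigcup_{i=1}^t\mathcal{X}_i$ be the disjoint union of fuzzy graphs $\mathcal{X}_1,\mathcal{X}_2,\dots,\mathcal{X}_t$. Then $$SDI(\mathcal{X})=\sum_{i=1}^t SDI(\mathcal{X}_i)+\sum_{i=1}^t\big(n-|\mathcal{V}(\mathcal{X}_i)|\big)\gamma_s(\mathcal{X}_i),$$ where $n=|\mathcal{V}(\mathcal{X})|$ and $|\mathcal{V}(\mathcal{X}_i)|$ is the number of vertices of $\mathcal{X}_i$.
   Context: A fuzzy graph $\mathcal{X}=(\mathcal{V},\varrho,\upsilon)$ consists of a nonempty finite set $\mathcal{V}=\mathcal{V}(\mathcal{X})$ of vertices, a function $\varrho:\mathcal{V}\to[0,1]$ and a symmetric function $\upsilon:\mathcal{V}\times\mathcal{V}\to[0,1]$ with $\upsilon(ab)\le\min(\varrho(a),\varrho(b))$ for all $a,b$, and no loops ($\upsilon(aa)=0$). It is assumed that $\varrho(a)>0$ for all $a\in\mathcal{V}$; pairs $ab$ with $\upsilon(ab)>0$ are called edges. The disjoint union of fuzzy graphs $\mathcal{X}_i=(\mathcal{V}_i,\varrho_i,\upsilon_i)$ with pairwise disjoint vertex sets has vertex set $\bigcup_i\mathcal{V}_i$, $\varrho(a)=\varrho_i(a)$ for $a\in\mathcal{V}_i$, $\upsilon(ab)=\upsilon_i(ab)$ for $a,b\in\mathcal{V}_i$, and $\upsilon(ab)=0$ otherwise. A path is a sequence of distinct vertices $a_1,\dots,a_m$ with $\upsilon(a_ia_{i+1})>0$ for all $i<m$;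 its strength is the minimum of the weights $\upsilon$ of its edges. The strength of connectedness between $a$ and $b$ is the maximum of the strengths of all paths from $a$ to $b$ (and $0$ if there is none). An edge $ab$ is strong if $\upsilon(ab)$ is at least the strength of connectedness between $a$ and $b$ in the fuzzy graph obtained by deleting the edge $ab$. A set $\mathcal{D}\subseteq\mathcal{V}$ is a strong dominating set (SDS) if every $b\in\mathcal{V}\setminus\mathcal{D}$ is joined by a strong edge to some $a\in\mathcal{D}$. An SDS $\mathcal{D}$ is a minimal strong dominating set (MSDS) if $\mathcal{D}\setminus\{a\}$ is not an SDS for every $a\in\mathcal{D}$. The weight of $\mathcal{S}\subseteq\mathcal{V}$ is $W(\mathcal{S})=\sum_{a\in\mathcal{S}}\min\{\upsilon(ab): ab \text{ is a strong edge}\}$; whenever weights are used it is understood that every vertex is incident with at least one strong edge. The strong domination number $\gamma_s$ is the minimum weight of an SDS; the strong domination degree ${}_{sd}d(u)$ of a vertex $u$ is the minimum of the weights of the MSDSs containing $u$; the strong domination index is $SDI(\mathcal{X})=\sum_{v\in\mathcal{V}}{}_{sd}d(v)$. *)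

(* Defs.v *)
From HB Require Import structures.
From mathcomp Require Import all_boot all_order all_algebra.
Set Implicit Arguments.
Unset Strict Implicit.
Unset Printing Implicit Defensive.
Import Order.TTheory GRing.Theory Num.Theory.
Local Open Scope ring_scope.

Record fuzzy_graph (R : realFieldType) (V : finType) := FuzzyGraph {
  rho : V -> R;
  ups : V -> V -> R;
  vertices_nonempty : (0 < #|V|)%N;
  rho_bounds : forall a, 0 < rho a <= 1;
  ups_bounds : forall a b, 0 <= ups a b <= 1;
  ups_sym : forall a b, ups a b = ups b a;
  ups_le_min : forall a b, ups a b <= Num.min (rho a) (rho b);
  ups_loopless : forall a, ups a a = 0
}.

Section FuzzyGraph.
Variables (R : realFieldType) (V : finType).
Implicit Types (X : fuzzy_graph R V) (a b u : V) (s : seq V) (D : {set V}).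

Definition edge X : rel V := fun a b => 0 < ups X a b.

(* A path is given by its first vertex a and the sequence s of the others. *)
Definition is_path X a b s : bool :=
  [&& uniq (a :: s), path (edge X) a s & last a s == b].

(* The default value 1 is neutral, since all the weights are at most 1. *)
Definition path_strength X a s : R :=
  \big[Num.min/1]_(w <- pairmap (ups X) a s) w.

(* Paths have distinct vertices, so sequences of size at most #|V| suffice. *)
Definition connectedness X a b : R :=
  \big[Num.max/0]_(s : {bseq #|V| of V} | is_path X a b s) path_strength X a s.

Definition delete_edge_ups X a b : V -> V -> R := fun u v =>
  if ((u == a) && (v == b)) || ((u == b) && (v == a)) then 0 else ups X u v.

Lemma delete_edge_ups_bounds X a b u v : 0 <= delete_edge_ups X a b u v <= 1.
Proof.
by rewrite /delete_edge_ups; case: ifP => _; rewrite ?lexx ?ler01 ?ups_bounds.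
Qed.

Lemma delete_edge_ups_sym X a b u v :
  delete_edge_ups X a b u v = delete_edge_ups X a b v u.
Proof.
by rewrite /delete_edge_ups orbC (andbC (u == b)) (andbC (u == a)) ups_sym.
Qed.

Lemma delete_edge_ups_le_min X a b u v :
  delete_edge_ups X a b u v <= Num.min (rho X u) (rho X v).
Proof.
apply: le_trans (ups_le_min X u v); rewrite /delete_edge_ups.
by case: ifP => // _; case/andP: (ups_bounds X u v).
Qed.

Lemma delete_edge_ups_loopless X a b u : delete_edge_ups X a b u u = 0.
Proof. by rewrite /delete_edge_ups ups_loopless if_same. Qed.

Definition delete_edge X a b : fuzzy_graph R V :=
  FuzzyGraph (vertices_nonempty X) (rho_bounds X)
    (delete_edge_ups_bounds X a b) (delete_edge_ups_sym X a b)
    (delete_edge_ups_le_min X a b) (delete_edge_ups_loopless X a b).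

Definition strong_edge X : rel V := fun a b =>
  edge X a b && (connectedness (delete_edge X a b) a b <= ups X a b).

Definition SDS X D : bool :=
  [forall b in ~: D, [exists a in D, strong_edge X a b]].

Definition MSDS X D : bool :=
  SDS X D && [forall a in D, ~~ SDS X (D :\ a)].

(* As for path_strength, the default value 1 is at least every edge weight; it
   is returned only when a is incident with no strong edge. *)
Definition min_strong_weight X a : R :=
  \big[Num.min/1]_(b | strong_edge X a b) ups X a b.

Definition weight X D : R := \sum_(a in D) min_strong_weight X a.

(* The whole vertex set is an SDS, so its weight is a neutral default value. *)
Definition strong_domination_number X : R :=
  \big[Num.min/weight X [set: V]]_(D : {set V} | SDS X D) weight X D.

(* Weights are nonnegative, so the default value is at least the weight of any
   set. Every u lies in an MSDS (a maximal set containing u with no two vertices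
   joined by a strong edge), so the minimum is over a nonempty family. *)
Definition strong_domination_degree X u : R :=
  \big[Num.min/weight X [set: V]]_(D : {set V} | MSDS X D && (u \in D))
    weight X D.

Definition SDI X : R := \sum_(u : V) strong_domination_degree X u.

End FuzzyGraph.

Section DisjointUnion.
Variables (R : realFieldType) (t : nat) (t_gt0 : (0 < t)%N).
Variables (V : 'I_t -> finType) (X : forall i, fuzzy_graph R (V i)).

Definition union_rho (a : {i : 'I_t & V i}) : R := rho (X (tag a)) (tagged a).

(* [tagged_as a b] is the vertex [tagged b] seen in the component of [a]. *)
Definition union_ups (a b : {i : 'I_t & V i}) : R :=
  if tag a == tag b then ups (X (tag a)) (tagged a) (tagged_as a b) else 0.

Lemma union_nonempty : (0 < #|{: {i : 'I_t & V i}}|)%N.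
Proof.
have /card_gt0P[v _] := vertices_nonempty (X (Ordinal t_gt0)).
by apply/card_gt0P; exists (Tagged (fun i => V i) v).
Qed.

Lemma union_rho_bounds a : 0 < union_rho a <= 1.
Proof. exact: rho_bounds. Qed.

Lemma union_ups_bounds a b : 0 <= union_ups a b <= 1.
Proof.
by rewrite /union_ups; case: ifP => _; rewrite ?lexx ?ler01 ?ups_bounds.
Qed.

Lemma union_ups_sym a b : union_ups a b = union_ups b a.
Proof.
case: a b => [i a] [j b]; rewrite /union_ups /= [j == i]eq_sym.
by case: (i =P j) => // eq_ij; subst j; rewrite !tagged_asE ups_sym.
Qed.

Lemma union_ups_le_min a b :
  union_ups a b <= Num.min (union_rho a) (union_rho b).
Proof.
case: a b => [i a] [j b]; rewrite /union_ups /union_rho /=.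
case: (i =P j) => [eq_ij|_].
  by subst j; rewrite tagged_asE ups_le_min.
have /andP[ra _] := rho_bounds (X i) a; have /andP[rb _] := rho_bounds (X j) b.
by rewrite le_min !ltW.
Qed.

Lemma union_ups_loopless a : union_ups a a = 0.
Proof. by case: a => i a; rewrite /union_ups eqxx tagged_asE ups_loopless. Qed.

Definition disjoint_union : fuzzy_graph R {i : 'I_t & V i} :=
  FuzzyGraph union_nonempty union_rho_bounds union_ups_bounds union_ups_sym
    union_ups_le_min union_ups_loopless.

End DisjointUnion.

(* Main.v *)
Require Import Defs.
From mathcomp Require Import all_boot all_order all_algebra.
Set Implicit Arguments.
Unset Strict Implicit.
Unset Printing Implicit Defensive.
Import Order.TTheory GRing.Theory Num.Theory.
Local Open Scope ring_scope.

(* An edge of one component is strong there iff it is strong in the union, so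
   the (M)SDSs of the union are exactly the unions of (M)SDSs of the components,
   and weights add up. A lightest MSDS through a vertex u of the component i is
   therefore a lightest one of that component through u together with lightest
   MSDSs of the other components; since weights are nonnegative, the latter
   have weight gamma_s. *)

(** * Strength of connectedness as reachability in threshold graphs *)

Section FuzzyGraphTheory.
Variables (R : realFieldType) (V : finType).
Implicit Types (X : fuzzy_graph R V).

(* Thresholding turns the max-min quantity [connectedness] into mere
   reachability in the crisp graphs [heavy X c]. *)
Definition heavy X (c : R) : rel V := fun u v => c <= ups X u v.

(** The bound [c <= 1] is what the empty sequence requires, its strength being the default 1. *)
Lemma le_path_strength X c a s :
  c <= 1 -> (c <= path_strength X a s) = path (heavy X c) a s.
Proof.
move=> c_le1; rewrite /path_strength.
elim: s a => [|b s IHs] a /=; first by rewrite big_nil.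
by rewrite big_cons le_min IHs.
Qed.

(** A walk in the threshold graph shortens to a repetition-free one, and positivity of [c] makes its
    steps edges. Positivity also keeps the default 0 of the maximum below [c]. *)
Lemma le_connectedness X c a b :
  0 < c <= 1 -> (c <= connectedness X a b) = connect (heavy X c) a b.
Proof.
move=> /andP[c_gt0 c_le1]; apply/idP/idP; last first.
  case/connectP=> p path_p ->.
  case/shortenP: path_p => q path_q uniq_q _.
  have size_q : (size q <= #|V|)%N.
    by apply: leq_trans (max_card (mem (a :: q))); rewrite (card_uniqP uniq_q).
  have q_path : is_path X a (last a q) (Bseq size_q).
    rewrite /is_path uniq_q eqxx andbT /=.
    by apply: sub_path path_q => u v; apply: lt_le_trans.
  pose strength (s : {bseq #|V| of V}) := path_strength X a s.
  apply: le_trans (le_bigmax_cond 0 strength q_path).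
  by rewrite le_path_strength.
apply: contraLR => not_ab; rewrite -ltNge; apply/bigmax_ltP; split=> // s.
case/and3P=> _ _ /eqP last_s; rewrite ltNge le_path_strength //.
by apply: contra not_ab => path_s; apply/connectP; exists s.
Qed.

Lemma connectedness_ge0 X a b : 0 <= connectedness X a b.
Proof. exact: bigmax_ge_id. Qed.

Lemma connectedness_le1 X a b : connectedness X a b <= 1.
Proof. by apply/bigmax_leP; split=> // s _; apply: bigmin_le_id. Qed.

Lemma heavy_sym X c : symmetric (heavy X c).
Proof. by move=> u v; rewrite /heavy ups_sym. Qed.

End FuzzyGraphTheory.

(** The hypothesis is applied at the single threshold [c = connectedness X a b]. The two vertex
    types may differ, so that a component can be compared with the union. *)
Lemma le_connectedness2 (R : realFieldType) (V W : finType)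
    (X : fuzzy_graph R V) (Y : fuzzy_graph R W) a b a' b' :
  (forall c, 0 < c -> connect (heavy X c) a b -> connect (heavy Y c) a' b') ->
  connectedness X a b <= connectedness Y a' b'.
Proof.
move=> XY; have := connectedness_ge0 X a b; rewrite le_eqVlt.
case/predU1P=> [<-|c_gt0]; first exact: connectedness_ge0.
have c01 : 0 < connectedness X a b <= 1 by rewrite c_gt0 connectedness_le1.
by rewrite le_connectedness // XY // -le_connectedness.
Qed.

(** * Existence of minimal strong dominating sets attaining the minima *)

Section StrongDomination.
Variables (R : realFieldType) (V : finType) (X : fuzzy_graph R V).
Implicit Types (a b u : V) (D : {set V}).

(** Deleting [ab] or [ba] gives the same weights, and reachability in a symmetric threshold graph is
    symmetric. *)
Lemma strong_edge_sym : symmetric (strong_edge X).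
Proof.
suff sub a b : strong_edge X a b -> strong_edge X b a.
  by move=> a b; apply/idP/idP; apply: sub.
rewrite /strong_edge /edge (ups_sym X b a) => /andP[-> /=]; apply: le_trans.
apply: le_connectedness2 => c _; rewrite (sym_connect_sym (@heavy_sym _ _ _ c)).
congr is_true; apply: eq_connect => u v.
by rewrite /heavy /= /delete_edge_ups orbC.
Qed.

Lemma strong_edge_irr a : strong_edge X a a = false.
Proof. by rewrite /strong_edge /edge ups_loopless ltxx. Qed.

Lemma SDSP D :
  reflect (forall b, b \notin D -> exists2 a, a \in D & strong_edge X a b)
    (SDS X D).
Proof.
apply: (iffP forall_inP) => sdsD b.
  by rewrite -in_setC => /sdsD/exists_inP.
by rewrite in_setC => /sdsD/exists_inP.
Qed.

Lemma SDS_setT : SDS X [set: V].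
Proof. by apply/SDSP => b; rewrite inE. Qed.

Lemma minset_MSDS D : minset (SDS X) D -> MSDS X D.
Proof.
case/minsetP=> sdsD minD; rewrite /MSDS sdsD; apply/forall_inP => a aD.
apply/negP => /minD/(_ (subD1set D a)) eqD.
by move: aD; rewrite -eqD !inE eqxx.
Qed.

Lemma MSDS_SDS D : MSDS X D -> SDS X D.
Proof. by case/andP. Qed.

Definition independent D : bool :=
  [forall a in D, forall b in D, ~~ strong_edge X a b].

Lemma independentP D :
  reflect {in D &, forall a b, ~~ strong_edge X a b} (independent D).
Proof.
apply: (iffP forall_inP) => [indD a b /indD/forall_inP|indD a aD]; first exact.
by apply/forall_inP => b; apply: indD.
Qed.

(** Maximality gives domination, and independence gives minimality: a vertex removed from [D] has no
    strong neighbour left in [D]. *)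
Lemma maxset_independent_MSDS D : maxset independent D -> MSDS X D.
Proof.
case/maxsetP=> /independentP indD maxD; apply/andP; split; last first.
  apply/forall_inP => a aD; apply/negP => /SDSP/(_ a).
  rewrite !inE eqxx => /(_ isT)[b /setD1P[_ bD]].
  by apply/negP/indD.
apply/SDSP => b bND; apply/exists_inP; apply: contraR bND.
rewrite negb_exists_in => /forall_inP no_edge.
(* A vertex [b] not dominated by [D] could be added to [D] without losing independence. *)
rewrite -(maxD _ _ (subsetUr [set b] D)) ?setU11 //.
apply/independentP => u v /setU1P[->|uD] /setU1P[->|vD].
- by rewrite strong_edge_irr.
- by rewrite strong_edge_sym no_edge.
- exact: no_edge.
- exact: indD.
Qed.

Lemma MSDS_exists u : exists2 D, MSDS X D & u \in D.
Proof.
have ind_u : independent [set u].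
  by apply/independentP => a b /set1P-> /set1P->; rewrite strong_edge_irr.
have [D maxD] := maxset_exists ind_u.
by rewrite sub1set; exists D; first apply: maxset_independent_MSDS.
Qed.

Lemma min_strong_weight_ge0 a : 0 <= min_strong_weight X a.
Proof. by apply: le_bigmin => // b _; case/andP: (ups_bounds X a b). Qed.

Lemma weightS D D' : D \subset D' -> weight X D <= weight X D'.
Proof.
move=> sDD'; rewrite /weight [leRHS](big_setID D) /= (setIidPr sDD').
by rewrite lerDl sumr_ge0 // => a _; apply: min_strong_weight_ge0.
Qed.

Lemma strong_domination_number_le D :
  SDS X D -> strong_domination_number X <= weight X D.
Proof. exact: bigmin_le_cond. Qed.

(** A lightest SDS contains an inclusion-minimal one, which is no heavier because weights are
    monotone. *)
Lemma strong_domination_number_MSDS :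
  exists2 D, MSDS X D & weight X D = strong_domination_number X.
Proof.
have [D sdsD wD] :
    {D | SDS X D & strong_domination_number X = weight X D}.
  apply: (eq_bigmin [set: V] (SDS X) (weight X) SDS_setT) => D _.
  exact/weightS/subsetT.
have [E minE sED] := minset_exists sdsD.
exists E; first exact: minset_MSDS.
have /MSDS_SDS sdsE := minset_MSDS minE.
apply/le_anti; rewrite strong_domination_number_le // andbT.
by rewrite wD weightS.
Qed.

Lemma strong_domination_degree_le D u :
  MSDS X D -> u \in D -> strong_domination_degree X u <= weight X D.
Proof. by move=> mD uD; apply: bigmin_le_cond; rewrite mD. Qed.

(** The family of MSDSs through [u] is nonempty and the default is at least each of their weights,
    so the minimum is attained in the family. *)
Lemma strong_domination_degree_MSDS u :
  exists D, [/\ MSDS X D, u \in D & weight X D = strong_domination_degree X u].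
Proof.
have [D0 mD0 uD0] := MSDS_exists u.
have [||D /andP[mD uD] wD] := @eq_bigmin _ _ _ (weight X [set: V]) D0
  (fun D => MSDS X D && (u \in D)) (weight X).
- by rewrite mD0.
- by move=> D _; apply/weightS/subsetT.
by exists D; split; rewrite // -wD.
Qed.

End StrongDomination.

(** * Strong edges, dominating sets and weights in a disjoint union *)

Section Union.
Variables (R : realFieldType) (t : nat) (t_gt0 : (0 < t)%N).
Variables (V : 'I_t -> finType) (X : forall i, fuzzy_graph R (V i)).
Local Notation U := (disjoint_union t_gt0 X).
Local Notation node a := (Tagged (fun i => V i) a).
Implicit Types (D : {set {i : 'I_t & V i}}).

Lemma ups_node i (a b : V i) : ups U (node a) (node b) = ups (X i) a b.
Proof. by rewrite /= /union_ups /= eqxx tagged_asE. Qed.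

Lemma ups_diff_tag x y : tag x != tag y -> ups U x y = 0.
Proof. by rewrite /= /union_ups => /negbTE->. Qed.

Lemma eq_node i (a b : V i) : (node a == node b) = (a == b).
Proof. exact: eq_Tagged. Qed.

Lemma delete_edge_node i (a b u v : V i) :
  ups (delete_edge U (node a) (node b)) (node u) (node v) =
  ups (delete_edge (X i) a b) u v.
Proof. by rewrite /= /delete_edge_ups !eq_node ups_node. Qed.

(** At a positive threshold a walk cannot leave the component in which it starts. *)
Lemma connectedness_node i (a b : V i) :
  connectedness (delete_edge U (node a) (node b)) (node a) (node b) =
  connectedness (delete_edge (X i) a b) a b.
Proof.
apply/le_anti/andP; split; apply: le_connectedness2 => c c_gt0.
  set Y := delete_edge _ _ _; case/connectP=> p.
  (* The start of the walk is generalized for the induction, while the deleted edge stays fixed. *)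
  suff sub (u : V i) : path (heavy Y c) (node u) p ->
      node b = last (node u) p -> connect (heavy (delete_edge (X i) a b) c) u b.
    exact: sub.
  elim: p u => [|[j v] p IHp] u /=.
    by move=> _ /eqP; rewrite eq_node => /eqP->.
  case/andP=> uv path_p last_p.
  have ij : i = j.
    apply/eqP; apply: contraLR uv => ij.
    rewrite /heavy /Y /= /delete_edge_ups ups_diff_tag // if_same.
    by rewrite -ltNge.
  subst j; apply: connect_trans (IHp v path_p last_p); apply: connect1.
  by rewrite /heavy -delete_edge_node.
case/connectP=> p path_p last_p; apply/connectP; exists [seq node v | v <- p].
  rewrite path_map; apply: sub_path path_p => u v.
  by rewrite /heavy -delete_edge_node.
by rewrite last_p (last_map (fun v => node v)).
Qed.

Lemma strong_edge_node i (a b : V i) :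
  strong_edge U (node a) (node b) = strong_edge (X i) a b.
Proof. by rewrite /strong_edge connectedness_node /edge ups_node. Qed.

Lemma strong_edge_tag x y : strong_edge U x y -> tag x = tag y.
Proof.
case/andP=> xy _; apply/eqP; apply: contraLR xy => neq_xy.
by rewrite /edge ups_diff_tag ?ltxx.
Qed.

Lemma min_strong_weight_node i (a : V i) :
  min_strong_weight U (node a) = min_strong_weight (X i) a.
Proof.
apply/le_anti/andP; split.
  apply: le_bigmin => [|b ab]; first exact: bigmin_le_id.
  by rewrite -ups_node; apply: bigmin_le_cond; rewrite strong_edge_node.
apply: le_bigmin => [|[j b] ab]; first exact: bigmin_le_id.
have /= ij := strong_edge_tag ab; subst j.
rewrite [leRHS](ups_node a b); apply: bigmin_le_cond.
by rewrite -strong_edge_node.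
Qed.

Definition component D i : {set V i} := [set a | node a \in D].

Definition assemble (E : forall i, {set V i}) : {set {i : 'I_t & V i}} :=
  [set x | tagged x \in E (tag x)].

Lemma assembleK E i : component (assemble E) i = E i.
Proof. by apply/setP => a; rewrite !inE. Qed.

Lemma weight_union D : weight U D = \sum_i weight (X i) (component D i).
Proof.
rewrite /weight (sig_big_dep xpredT (fun i a => a \in component D i)
  (fun i a => min_strong_weight (X i) a)) /=.
apply: eq_big => [[i a]|[i a] _]; first by rewrite inE.
exact: min_strong_weight_node.
Qed.

Lemma SDS_union D :
  reflect (forall i, SDS (X i) (component D i)) (SDS U D).
Proof.
apply: (iffP (SDSP _ _)) => [sdsD i|sdsD [i b] bND].
  apply/SDSP => b; rewrite inE => /sdsD[[j a] aD ab].
  have /= ji := strong_edge_tag ab; subst j.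
  by exists a; rewrite ?inE // -strong_edge_node.
have [|a aD ab] := SDSP _ _ (sdsD i) b; first by rewrite inE.
by exists (node a); [rewrite inE in aD | rewrite strong_edge_node].
Qed.

Lemma component_setD1 D i (a : V i) :
  component (D :\ node a) i = component D i :\ a.
Proof. by apply/setP => b; rewrite !inE eq_node. Qed.

Lemma component_setD1_neq D i j (a : V i) :
  j != i -> component (D :\ node a) j = component D j.
Proof.
move=> neq_ji; apply/setP => b; rewrite !inE.
by case: eqP => // /(congr1 tag) /= eq_ji; rewrite eq_ji eqxx in neq_ji.
Qed.

(** Removing a vertex of component [i] leaves the other components of the set unchanged, so whether
    domination fails is decided in component [i] alone. *)
Lemma MSDS_union D :
  reflect (forall i, MSDS (X i) (component D i)) (MSDS U D).
Proof.
apply: (iffP andP) => [[/SDS_union sdsD /forall_inP minD] i|mD].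
  rewrite /MSDS sdsD; apply/forall_inP => a aD.
  have /minD : node a \in D by rewrite inE in aD.
  apply: contra => sdsDa; apply/SDS_union => j.
  case: (eqVneq j i) => [->|neq_ji]; first by rewrite component_setD1.
  by rewrite component_setD1_neq.
split; first by apply/SDS_union => i; apply: MSDS_SDS.
apply/forall_inP => [[i a] aD]; have /andP[_ /forall_inP/(_ a)] := mD i.
rewrite inE => /(_ aD); apply: contra => /SDS_union/(_ i).
by rewrite component_setD1.
Qed.

Lemma strong_domination_degree_union i (u : V i) :
  strong_domination_degree U (node u) =
  strong_domination_degree (X i) u +
    \sum_(j | j != i) strong_domination_number (X j).
Proof.
apply/le_anti/andP; split.
  have [D [mD uD wD]] := strong_domination_degree_MSDS (X i) u.
  (* The family must be [D] at [i] and a lightest MSDS elsewhere. As [V j] depends on [j], agreement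
     with [D] is stated through a cast along [i = j]; finite choice then collects the sets, and the
     cast vanishes at [erefl]. *)
  have mE j : exists E : {set V j},
      [/\ MSDS (X j) E,
          j != i -> weight (X j) E = strong_domination_number (X j) &
          forall ij : i = j, E = ecast j {set V j} ij D].
    case: (eqVneq i j) => [ij|neq_ij].
      by subst j; exists D; split=> // ii; rewrite eq_axiomK.
    have [E mE wE] := strong_domination_number_MSDS (X j).
    by exists E; split=> // ij; rewrite ij eqxx in neq_ij.
  have [E {}mE] := fin_all_exists mE.
  have Ei : E i = D by have [_ _ /(_ erefl)] := mE i.
  have mU : MSDS U (assemble E).
    by apply/MSDS_union => j; rewrite assembleK; case: (mE j).
  have uU : node u \in assemble E by rewrite inE /= Ei.
  apply: le_trans (strong_domination_degree_le mU uU) _.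
  rewrite weight_union (bigD1 i) //= assembleK Ei wD lerD2l.
  apply: ler_sum => j neq_ji; rewrite assembleK.
  by have [_ -> //] := mE j.
(* Conversely, an optimal MSDS of the union through [node u] is bounded below component by
   component. *)
have [D [/MSDS_union mD uD <-]] := strong_domination_degree_MSDS U (node u).
rewrite weight_union [leRHS](bigD1 i) //=; apply: lerD.
  by apply: strong_domination_degree_le; rewrite ?inE.
by apply: ler_sum => j _; apply/strong_domination_number_le/MSDS_SDS.
Qed.

End Union.

Theorem theorem4p21 (R : realFieldType) (t : nat) (t_gt0 : (0 < t)%N)
    (V : 'I_t -> finType) (X : forall i : 'I_t, fuzzy_graph R (V i))
    (strongX : forall (i : 'I_t) (a : V i), exists b, strong_edge (X i) a b) :
  let n := #|{: {i : 'I_t & V i}}| in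
  SDI (disjoint_union t_gt0 X) =
    \sum_(i < t) SDI (X i) +
    \sum_(i < t) (n%:R - #|V i|%:R) * strong_domination_number (X i).
Proof.
move=> n; pose g i := strong_domination_number (X i).
have n_sum : n%:R = \sum_i #|V i|%:R :> R.
  by rewrite /n card_tagged sumnE big_map big_enum natr_sum.
(* The sum over [j != i] is written as the full sum minus [g i], so that the full sum no longer
   depends on [i]. *)
have -> : SDI (disjoint_union t_gt0 X) =
    \sum_i \sum_(a : V i)
      (strong_domination_degree (X i) a + (\sum_j g j - g i)).
  rewrite sig_big_dep; apply: eq_bigr => [[i a] _].
  rewrite strong_domination_degree_union (bigD1 i (P := xpredT)) //=.
  by rewrite [g i + _]addrC addrK.
(* Summing the second terms over all vertices gives [n] times the sum of [g], minus the sum of the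
   [#|V i| * g i]. *)
under eq_bigr do rewrite big_split /= sumr_const -mulr_natl mulrBr.
rewrite big_split /= sumrB -mulr_suml -n_sum mulr_sumr -sumrB.
by congr (_ + _); apply: eq_bigr => i _; rewrite mulrBl.
Qed.
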